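(* Let $\mathsf{C2.FM}$ be $\mathsf{C2.F}$ plus the McKinsey axiom schema $\Box\Diamond p\to\Diamond\Box p$. Then $\mathsf{C2.FM}$ is sound and weakly complete with respect to final ordinal sequence frames: for every $p\in\mathcal{L}_>$, $\vdash_{\mathsf{C2.FM}}p$ if and only if $p$ is true at every element of every order model based on a final ordinal sequence frame.
   Context: Language. Let $At=\{p_0,p_1,\ldots\}$ be a countably infinite set of atoms. $\mathcal{L}_>$ is generated by $p ::= p_k\in At\mid \neg p\mid (p\wedge p)\mid (p>p)$; $\vee,\to,\leftrightarrow$ are defined as usual; $\Box p$ abbreviates $\neg p>p$, and $\Diamond p$ abbreviates $\neg\Box\neg p$. Logics. $\mathsf{C2}$ is the smallest set of $\mathcal{L}_>$-sentences containing all instances of: (PC) every (substitution instance of a) theorem of classical propositional logic; (Identity) $p>p$; (Reciprocity) $(p>q)\wedge(q>p)\wedge(p>r)\to(q>r)$; (MP) $(p>q)\to(p\to q)$; (CEM) $(p>q)\vee(p>\neg q)$; and closed under (Detachment) from $\vdash p\to q$ and $\vdash p$ infer $\vdash q$; (Normality) from $\vdash(p\wedge q)\to r$ infer $\vdash((s>p)\wedge(s>q))\to(s>r)$. $\mathsf{C2.F}$ is the smallest extension of $\mathsf{C2}$ containing every instance of (Flattening) $(p>((p\wedge q)>r))\leftrightarrow((p\wedge q)>r)$ and closed under Detachment and Normality. Adding a schema to a logic means taking the smallest extension containing every instance of the schema and closed under Detachment and Normality. Order frames and models. An order frame is a pair $\langle W,<\rangle$ where $W\neq\varnothing$ and $<$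 is a function taking each $w\in W$ to a strict well-order $<_w$ on some subset of $W$ such that whenever $x<_w y$, either $w=x$ or $w<_w x$. Put $R(w)=\{w\}\cup\{v: w<_w v\}$. An order model $\langle W,<,V\rangle$ adds a valuation $V:At\times W\to\{0,1\}$; put $V(p_k)=\{w:V(p_k,w)=1\}$. Denotations: $[\![p_k]\!]=V(p_k)$, $[\![\neg p]\!]=W\setminus[\![p]\!]$, $[\![p\wedge q]\!]=[\![p]\!]\cap[\![q]\!]$, and $w\in[\![p>q]\!]$ iff either $R(w)\cap[\![p]\!]=\varnothing$, or there is $y\in R(w)\cap[\![p]\!]\cap[\![q]\!]$ such that $x\notin[\![p]\!]$ whenever $x<_w y$. A sentence $p$ is true at $w$ iff $w\in[\![p]\!]$. Ordinal sequences. For an ordinal $\alpha$ and non-empty set $P$, an $\alpha$-sequence over $P$ is a function $\sigma:\alpha\to P$. For $\beta\le\alpha$ the $\beta$th tail $\sigma^{[\beta:]}$ is the sequence of length $\alpha-\beta$ with $\sigma^{[\beta:]}(\gamma)=\sigma(\beta+\gamma)$; the rank in $\sigma$ of a tail $\tau$ of $\sigma$ is the least $\beta$ with $\tau=\sigma^{[\beta:]}$. The tail order function $\prec^W$ on a set $W$ of ordinal sequences has $\tau\prec^W_\sigma\rho$ iff $\tau,\rho,\sigma\in W$, $\tau$ and $\rho$ are tails of $\sigma$, and the rank of $\tau$ in $\sigma$ is less than the rank of $\rho$ in $\sigma$. An ordinal sequence frame is an order frame $\langle W,\prec^W\rangle$ where $W$ is a set of ordinal sequences (finite or transfinite; $W$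 is not required to be closed under tails or to exclude the empty sequence). A final ordinal sequence frame is an ordinal sequence frame $\langle W,\prec^W\rangle$ such that whenever $\sigma\in W$, there exists $\beta$ such that $\sigma^{[\beta:]}\in W$ and, whenever $\gamma\ge\beta$ and $\sigma^{[\gamma:]}$ is defined and in $W$, $\sigma^{[\gamma:]}=\sigma^{[\beta:]}$. *)

(* Defs.v *)
From HB Require Import structures.
From mathcomp Require Import all_boot boolp classical_sets.

Set Implicit Arguments.
Unset Strict Implicit.
Unset Printing Implicit Defensive.

Local Open Scope classical_set_scope.
Local Open Scope quotient_scope.

Declare Scope cond_scope.
Delimit Scope cond_scope with cond.

(** * The conditional language *)

Inductive sentence : Type :=
| Atom of nat
| Neg of sentence
| And of sentence & sentence
| Cond of sentence & sentence.

Bind Scope cond_scope with sentence.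

Definition Or (p q : sentence) := Neg (And (Neg p) (Neg q)).
Definition Imp (p q : sentence) := Neg (And p (Neg q)).
Definition Iff (p q : sentence) := And (Imp p q) (Imp q p).
Definition Box (p : sentence) := Cond (Neg p) p.
Definition Dia (p : sentence) := Neg (Box (Neg p)).

Notation "¬ p" := (Neg p) (at level 35, right associativity) : cond_scope.
Notation "□ p" := (Box p) (at level 35, right associativity) : cond_scope.
Notation "◇ p" := (Dia p) (at level 35, right associativity) : cond_scope.
Notation "p ∧ q" := (And p q) (at level 40, left associativity) : cond_scope.
Notation "p ∨ q" := (Or p q) (at level 50, left associativity) : cond_scope.
Notation "p ▷ q" := (Cond p q) (at level 55, no associativity) : cond_scope.
Notation "p → q" := (Imp p q) (at level 60, right associativity) : cond_scope.
Notation "p ↔ q" := (Iff p q) (at level 65, no associativity) : cond_scope.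

(** * Logics *)

Inductive pform : Type :=
| PVar of nat
| PNeg of pform
| PAnd of pform & pform.

Fixpoint peval (v : nat -> bool) (a : pform) : bool :=
  match a with
  | PVar n => v n
  | PNeg b => ~~ peval v b
  | PAnd b c => peval v b && peval v c
  end.

Definition tautology (a : pform) : Prop := forall v, peval v a.

Fixpoint psubst (s : nat -> sentence) (a : pform) : sentence :=
  match a with
  | PVar n => s n
  | PNeg b => Neg (psubst s b)
  | PAnd b c => And (psubst s b) (psubst s c)
  end.

Inductive closure (A : set sentence) : set sentence :=
| closure_base p : A p -> closure A p
| closure_detachment p q :
    closure A (p → q)%cond -> closure A p -> closure A q
| closure_normality p q r s :
    closure A (p ∧ q → r)%cond ->
    closure A ((s ▷ p) ∧ (s ▷ q) → (s ▷ r))%cond.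

Definition add_schema (L S : set sentence) : set sentence := closure (L `|` S).

Inductive C2_axiom : set sentence :=
| C2_PC a s : tautology a -> C2_axiom (psubst s a)
| C2_Identity p : C2_axiom (p ▷ p)%cond
| C2_Reciprocity p q r :
    C2_axiom ((p ▷ q) ∧ (q ▷ p) ∧ (p ▷ r) → (q ▷ r))%cond
| C2_MP p q : C2_axiom ((p ▷ q) → (p → q))%cond
| C2_CEM p q : C2_axiom ((p ▷ q) ∨ (p ▷ ¬ q))%cond.

Inductive flattening : set sentence :=
| Flattening p q r :
    flattening ((p ▷ ((p ∧ q) ▷ r)) ↔ ((p ∧ q) ▷ r))%cond.

Inductive mckinsey : set sentence :=
| McKinsey p : mckinsey (□ ◇ p → ◇ □ p)%cond.

Definition C2 : set sentence := closure C2_axiom.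
Definition C2F : set sentence := add_schema C2 flattening.
Definition C2FM : set sentence := add_schema C2F mckinsey.

(** * Order frames and models

    A frame is given by a set [W] of points of an ambient type [T]; [lt w] is
    the order <_w, so [lt w x y] reads x <_w y. *)

Record strict_well_order (T : Type) (D : set T) (r : T -> T -> Prop) : Prop := {
  swo_dom : forall x y, r x y -> D x /\ D y;
  swo_irr : forall x, ~ r x x;
  swo_trans : forall x y z, r x y -> r y z -> r x z;
  swo_total : forall x y, D x -> D y -> [\/ r x y, x = y | r y x];
  swo_min : forall S : set T, S `<=` D -> S !=set0 ->
    exists2 x, S x & forall y, S y -> ~ r y x }.

Record order_frame (T : Type) (W : set T) (lt : T -> T -> T -> Prop) : Prop := {
  of_nonempty : W !=set0;
  of_wo : forall w, W w ->
    exists2 D : set T, D `<=` W & strict_well_order D (lt w);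
  of_center : forall w x y, W w -> lt w x y -> w = x \/ lt w w x }.

Section Denotation.
Variables (T : Type) (W : set T) (lt : T -> T -> T -> Prop).

Definition reach (w : T) : set T := [set w] `|` [set v | lt w w v].

(* Values of the valuation [V] outside [W] are ignored. *)
Fixpoint denot (V : nat -> T -> bool) (p : sentence) : set T :=
  match p with
  | Atom k => [set w | W w /\ V k w]
  | Neg p => W `\` denot V p
  | And p q => denot V p `&` denot V q
  | Cond p q => [set w | W w /\
      (reach w `&` denot V p = set0 \/
       exists2 y, (reach w `&` denot V p `&` denot V q) y &
                  forall x, lt w x y -> ~ denot V p x)]
  end.

Definition frame_valid (p : sentence) : Prop :=
  forall (V : nat -> T -> bool) w, W w -> denot V p w.

End Denotation.

(** * Ordinals

    Ordinals are isomorphism classes of well-ordered types. *)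

Record woType : Type := WoType {
  wo_sort :> Type;
  wo_lt : wo_sort -> wo_sort -> Prop;
  woP : strict_well_order [set: wo_sort] wo_lt }.
Arguments wo_lt {w}.

HB.instance Definition _ := gen_eqMixin woType.
HB.instance Definition _ := gen_choiceMixin woType.

Definition wo_iso (A B : woType) : bool :=
  `[< exists2 f : A -> B, bijective f &
        forall x y, wo_lt x y <-> wo_lt (f x) (f y) >].

Lemma wo_iso_refl : reflexive wo_iso.
Proof. by move=> A; apply/asboolP; exists id => //; exists id. Qed.

Lemma wo_iso_sym : symmetric wo_iso.
Proof.
suff H A B : wo_iso A B -> wo_iso B A by move=> A B; apply/idP/idP; apply: H.
move=> /asboolP [f [g fK gK] fP]; apply/asboolP; exists g; first by exists f.
by move=> x y; rewrite fP !gK.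
Qed.

Lemma wo_iso_trans : transitive wo_iso.
Proof.
move=> B A C /asboolP [f fb fP] /asboolP [g gb gP]; apply/asboolP.
exists (g \o f); first exact: bij_comp.
by move=> x y; rewrite fP gP.
Qed.

Canonical wo_iso_equiv := EquivRel wo_iso wo_iso_refl wo_iso_sym wo_iso_trans.

Definition Ord : Type := {eq_quot wo_iso_equiv}.

Definition otype (A : woType) : Ord := \pi_({eq_quot wo_iso_equiv}) A.
Definition orepr (α : Ord) : woType := repr (α : {eq_quot wo_iso_equiv}).

Lemma oreprK : cancel orepr otype.
Proof. exact: reprK. Qed.

Lemma otypeP (A B : woType) : otype A = otype B <-> wo_iso A B.
Proof. by split=> [/eqmodP|h]; last apply/eqmodP. Qed.

Lemma wo_segP (A : woType) (a : A) :
  strict_well_order [set: {x : A | wo_lt x a}]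
    (fun x y => wo_lt (sval x) (sval y)).
Proof.
have [_ irr tr tot mn] := woP A; split => //.
- by move=> x y z; exact: tr (sval x) (sval y) (sval z).
- move=> x y _ _; case: (tot (sval x) (sval y)) => // [h|/eq_sig_hprop h|h].
  + by constructor 1.
  + by constructor 2; apply: h => ? ? ?; apply: Prop_irrelevance.
  + by constructor 3.
- move=> S _ [s Ss].
  have [//||_ [x Sx <-] xmin] := mn (sval @` S); first by exists (sval s), s.
  by exists x => // y Sy; apply: xmin; exists y.
Qed.

Definition wo_seg (A : woType) (a : A) : woType := WoType (wo_segP a).

Definition sum_lt (A B : woType) (u v : A + B) : Prop :=
  match u, v with
  | inl x, inl y => wo_lt x y
  | inl _, inr _ => True
  | inr _, inl _ => False
  | inr x, inr y => wo_lt x y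
  end.

Lemma wo_sumP (A B : woType) : strict_well_order [set: A + B] (@sum_lt A B).
Proof.
have [_ irrA trA totA mnA] := woP A; have [_ irrB trB totB mnB] := woP B.
split => //.
- by case=> x; [apply: irrA | apply: irrB].
- by case=> x [y|y] [z|z] //=; [apply: trA | apply: trB].
- case=> x [y|y] _ _; rewrite /sum_lt; try by [constructor 1|constructor 3].
  + by case: (totA x y) => // [h|->|h];
      [constructor 1 | constructor 2 | constructor 3].
  + by case: (totB x y) => // [h|->|h];
      [constructor 1 | constructor 2 | constructor 3].
- move=> S _ [s Ss].
  have [[x0 Sx0]|noA] := pselect (exists x, S (inl x)).
    have [//||x Sx xmin] := mnA [set x | S (inl x)]; first by exists x0.
    by exists (inl x) => // -[y|y] Sy; [exact: xmin | case].
  case: s Ss => [x Sx|x0 Sx0]; first by case: noA; exists x.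
  have [//||x Sx xmin] := mnB [set x | S (inr x)]; first by exists x0.
  exists (inr x) => // -[y|y] Sy; first by case: noA; exists y.
  exact: xmin Sy.
Qed.

Definition wo_sum (A B : woType) : woType := WoType (@wo_sumP A B).

Definition olt (α β : Ord) : Prop := exists b : orepr β, α = otype (wo_seg b).
Definition ole (α β : Ord) : Prop := olt α β \/ α = β.
Definition oadd (α β : Ord) : Ord := otype (wo_sum (orepr α) (orepr β)).

(** * Ordinal sequences *)

Record oseq (P : Type) : Type := OSeq {
  olen : Ord;
  oval : {γ : Ord | olt γ olen} -> P }.

(* [is_tail σ β τ]: the tail σ^{[β:]} is defined and equals τ.  The first clause
   says that β is at most the length α of σ and that τ has length α - β. *)
Definition is_tail (P : Type) (σ : oseq P) (β : Ord) (τ : oseq P) : Prop :=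
  oadd β (olen τ) = olen σ /\
  forall (γ : Ord) (hτ : olt γ (olen τ)) (hσ : olt (oadd β γ) (olen σ)),
    oval (exist _ γ hτ) = oval (exist _ (oadd β γ) hσ).

Definition is_rank (P : Type) (σ τ : oseq P) (β : Ord) : Prop :=
  is_tail σ β τ /\ forall γ, is_tail σ γ τ -> ole β γ.

Definition tail_order (P : Type) (W : set (oseq P)) (σ τ ρ : oseq P) : Prop :=
  [/\ W τ, W ρ & W σ] /\
  exists β γ, [/\ is_rank σ τ β, is_rank σ ρ γ & olt β γ].

Definition ordinal_sequence_frame (P : Type) (W : set (oseq P)) : Prop :=
  order_frame W (tail_order W).

Definition final_ordinal_sequence_frame (P : Type) (W : set (oseq P)) : Prop :=
  ordinal_sequence_frame W /\
  forall σ, W σ -> exists β τ, [/\ is_tail σ β τ, W τ &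
    forall γ ρ, ole β γ -> is_tail σ γ ρ -> W ρ -> ρ = τ].

(* Main.v *)
(* Both directions rest on reading [p ▷ q] at a sequence as: the tail of least
   index satisfying [p], if any, satisfies [q].  Flattening is sound because a tail
   of a tail is a tail, and McKinsey because a final tail only sees itself.

   For completeness, let [G] be a maximal consistent set refuting [p].  Whenever [f]
   is possible at [G], [{q | G (f ▷ q)}] is again maximal consistent, the nearest
   [f]-point to [G].  Starting from [G], build a transfinite sequence of maximal
   consistent sets: at stage [a], go to the nearest point whose state (its truth
   values on the finitely many formulas relevant to [p]) does not occur cofinally
   below [a].  Flattening implies that, as long as [f] has not been met, the nearest
   [f]-point stays the same, so each tail meets the relevant formulas first where
   its head says it should.  By the McKinsey axiom every point sees a settled one,
   which decides the necessity of each subsentence of [p] or of its negation, so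
   the construction can only get stuck once it has met a settled point.  It meets
   one before the first uncountable ordinal: otherwise, take a countable limit
   below which exactly the states that are cofinal in the whole sequence recur; the
   point chosen there has a state that is not cofinal, yet lies beyond all
   occurrences of such states.  Cut off at the first settled point, the sequence
   has a final tail, and its non-empty tails form the required frame. *)

Require Import Defs.
From mathcomp Require Import all_boot boolp classical_sets.
From mathcomp Require Import cardinality wochoice.
From HB Require Import structures.

Set Implicit Arguments.
Unset Strict Implicit.
Unset Printing Implicit Defensive.

Local Open Scope classical_set_scope.

(** * Ordinals *)

Lemma wo_irr (A : woType) (x : A) : ~ wo_lt x x.
Proof. exact: swo_irr (woP A) x. Qed.

Lemma wo_trans (A : woType) (x y z : A) : wo_lt x y -> wo_lt y z -> wo_lt x z.
Proof. exact: swo_trans (woP A) x y z. Qed.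

Lemma wo_total (A : woType) (x y : A) : [\/ wo_lt x y, x = y | wo_lt y x].
Proof. exact: (swo_total (woP A)). Qed.

Lemma wo_min (A : woType) (S : set A) : S !=set0 ->
  exists2 x, S x & forall y, S y -> ~ wo_lt y x.
Proof. exact: (swo_min (woP A)). Qed.

Lemma wo_ind (A : woType) (P : A -> Prop) :
  (forall x, (forall y, wo_lt y x -> P y) -> P x) -> forall x, P x.
Proof.
move=> IH x; apply: contrapT => nPx.
have [y nPy ymin] := @wo_min A [set y | ~ P y] (ex_intro _ x nPx).
by apply: nPy; apply: IH => z zy; apply: contrapT => /ymin.
Qed.

Lemma wo_notlt (A : woType) (x y : A) : ~ wo_lt x y -> y = x \/ wo_lt y x.
Proof. by case: (wo_total x y) => h nh; [case: (nh h)|left|right]. Qed.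

Lemma wo_le_lt_trans (A : woType) (x y z : A) :
  ~ wo_lt y x -> wo_lt y z -> wo_lt x z.
Proof. by move=> /wo_notlt[->//|]; apply: wo_trans. Qed.

Lemma wo_lt_le_trans (A : woType) (x y z : A) :
  wo_lt x y -> ~ wo_lt z y -> wo_lt x z.
Proof. by move=> xy /wo_notlt[<-//|]; apply: wo_trans. Qed.

Lemma wo_le_trans (A : woType) (x y z : A) :
  ~ wo_lt y x -> ~ wo_lt z y -> ~ wo_lt z x.
Proof. by move=> yx zy /(wo_lt_le_trans)/(_ yx). Qed.

Lemma wo_asym (A : woType) (x y : A) : wo_lt x y -> ~ wo_lt y x.
Proof. by move=> xy /(wo_trans xy)/wo_irr. Qed.

Lemma wo_max (A : woType) (x y : A) :
  exists z, [/\ ~ wo_lt z x, ~ wo_lt z y & z = x \/ z = y].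
Proof.
case: (wo_total x y) => [xy|->|yx]; [exists y|exists y|exists x];
  by split; auto; try exact: wo_irr; exact: wo_asym.
Qed.

Lemma wo_increasing_ge (A : woType) (f : A -> A) (x : A) :
  {homo f : x y / wo_lt x y} -> ~ wo_lt (f x) x.
Proof. by move=> fI; elim/wo_ind: x => x IH fx; apply: (IH _ fx); apply: fI. Qed.

Lemma wo_isoI (A B : woType) (f : A -> B) :
  {homo f : x y / wo_lt x y} -> (forall y, exists x, f x = y) -> wo_iso A B.
Proof.
move=> fI /choice[g gK]; apply/asboolP; exists f.
  exists g => // x; case: (wo_total (g (f x)) x) => // /fI; rewrite gK => /wo_irr//.
move=> x y; split=> [/fI//|fxy]; case: (wo_total x y) => //.
  by move=> E; move: fxy; rewrite E => /wo_irr.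
by move=> /fI /wo_asym.
Qed.

Lemma wo_seg_iso (A B : woType) : wo_iso A B ->
  exists f : A -> B, forall a, wo_iso (wo_seg a) (wo_seg (f a)).
Proof.
move=> /asboolP[f [g fK gK] fP]; exists f => a.
apply: (@wo_isoI (wo_seg a) (wo_seg (f a)) (fun u =>
  exist (fun y => wo_lt y (f a)) (f (sval u)) ((fP _ _).1 (svalP u)))).
  by move=> u v /fP.
case=> y ya; have ga : wo_lt (g y) a by apply/fP; rewrite gK.
by exists (exist _ (g y) ga); apply: eq_exist => /=; rewrite gK.
Qed.

Lemma wo_seg_seg (A : woType) (b : A) (u : wo_seg b) :
  wo_iso (wo_seg u) (wo_seg (sval u)).
Proof.
apply: (@wo_isoI (wo_seg u) (wo_seg (sval u)) (fun v =>
  exist (fun y => wo_lt y (sval u)) (sval (sval v)) (svalP v))) => //.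
case=> y yu; have yb := wo_trans yu (svalP u).
by exists (exist (fun v : wo_seg b => wo_lt v u) (exist _ y yb) yu); apply: eq_exist.
Qed.

(** Elements of any well-order of type α name the ordinals below α through their [orank], so the
    representative chosen by [orepr] rarely matters. *)
Definition orank (A : woType) (a : A) : Ord := otype (wo_seg a).

Lemma ltoP (B : woType) (α : Ord) : olt α (otype B) <-> exists b : B, α = orank b.
Proof.
have iso : wo_iso (orepr (otype B)) B by apply/otypeP; rewrite oreprK.
split=> -[b ->].
  by have [f fP] := wo_seg_iso iso; exists (f b); apply/otypeP/fP.
have [f fP] := wo_seg_iso (etrans (wo_iso_sym _ _) iso).
by exists (f b); apply/otypeP/fP.
Qed.

Lemma orank_sval (A : woType) (b : A) (u : wo_seg b) : orank u = orank (sval u).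
Proof. by apply/otypeP/wo_seg_seg. Qed.

Lemma lt_orankP (A : woType) (a : A) (α : Ord) :
  olt α (orank a) <-> exists2 b, wo_lt b a & α = orank b.
Proof.
split=> [/ltoP[u ->]|[b ba ->]].
  by exists (sval u); [exact: (svalP u)|exact: orank_sval].
by apply/(@ltoP (wo_seg a)); exists (exist _ b ba); rewrite orank_sval.
Qed.

(** An isomorphism of [A] onto its segment below [a] would be an increasing self-map of [A] sending
    [a] below itself. *)
Lemma orank_otype_neq (A : woType) (a : A) : orank a <> otype A.
Proof.
move=> /otypeP/(etrans (wo_iso_sym _ _))/asboolP[f _ fP].
apply: (@wo_increasing_ge A (fun x => sval (f x)) a) => [x y xy|]; last exact: (svalP (f a)).
exact: (fP x y).1.
Qed.

Lemma olt_irr (α : Ord) : ~ olt α α.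
Proof. by rewrite -(oreprK α) => /ltoP[a /esym/orank_otype_neq]. Qed.

Lemma olt_trans (α β γ : Ord) : olt α β -> olt β γ -> olt α γ.
Proof.
rewrite -(oreprK γ) => + /ltoP[a E]; rewrite {}E => /lt_orankP[b _ ->].
by apply/ltoP; exists b.
Qed.

Lemma orank_lt (A : woType) (a b : A) : olt (orank a) (orank b) <-> wo_lt a b.
Proof.
split=> [|ab]; last by apply/lt_orankP; exists a.
case: (wo_total a b) => // [->/olt_irr//|ba /olt_trans]/(_ (orank a)).
by case/(_ _)/olt_irr; apply/lt_orankP; exists b.
Qed.

Lemma orank_inj (A : woType) : injective (@orank A).
Proof.
by move=> a b E; case: (wo_total a b) => // /orank_lt; rewrite E => /olt_irr.
Qed.

(** Matching ranks defines an increasing map with downward closed range. Either it is onto, or its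
    range is the segment below the least missed element. *)
Lemma wo_compare (A B : woType) : (forall a : A, exists b : B, orank a = orank b) ->
  wo_iso A B \/ exists b : B, wo_iso A (wo_seg b).
Proof.
move=> /choice[f fE].
have fI : {homo f : x y / wo_lt x y} by move=> x y /orank_lt; rewrite !fE => /orank_lt.
have [surj|/existsNP[b nb]] := pselect (forall b, exists a, f a = b).
  by left; apply: wo_isoI surj.
have [b0 nb0 b0min] := @wo_min B [set b | ~ exists a, f a = b] (ex_intro _ b nb).
right; exists b0; have fb a : wo_lt (f a) b0.
  apply: contrapT => /wo_notlt[E|b0fa]; first by apply: nb0; exists a.
  move: b0fa => /orank_lt; rewrite -fE => /lt_orankP[c _ E].
  by apply: nb0; exists c; apply: orank_inj; rewrite -fE.
apply: (@wo_isoI A (wo_seg b0) (fun a => exist (fun y => wo_lt y b0) (f a) (fb a))) => //.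
move=> [y yb0]; have /contrapT[a fa] := contra_not (@b0min y) (fun k => k yb0).
by exists a; apply: eq_exist.
Qed.

Lemma olt_total (α β : Ord) : [\/ olt α β, α = β | olt β α].
Proof.
rewrite -(oreprK α) -(oreprK β); set A := orepr α; set B := orepr β.
have [/wo_compare[/otypeP->|[b /otypeP E]]|/existsNP[a na]] :=
    pselect (forall a : A, exists b : B, orank a = orank b).
- by constructor 2.
- by constructor 1; apply/ltoP; exists b.
(* All ranks below [a0] are matched in [B], so [wo_compare] applies to that segment. It cannot be
   isomorphic to a segment of [B], as [a0] is unmatched, so it has the type of [B]. *)
have [a0 na0 a0min] := @wo_min A [set a : A | ~ exists b : B, orank a = orank b]
  (ex_intro _ a na).
have : forall u : wo_seg a0, exists b : B, orank u = orank b.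
  move=> u; have := contra_not (@a0min (sval u)) (fun k => k (svalP u)).
  by move=> /contrapT[b E]; exists b; rewrite orank_sval.
move=> /wo_compare[/otypeP E|[b /otypeP E]]; last by case: na0; exists b.
by constructor 3; apply/ltoP; exists a0.
Qed.

Lemma olt_min (S : set Ord) : S !=set0 ->
  exists2 α, S α & forall β, S β -> ~ olt β α.
Proof.
move=> [α Sα]; have [[β Sβ βα]|nS] := pselect (exists2 β, S β & olt β α); last first.
  by exists α => // β Sβ βα; apply: nS; exists β.
move: βα Sβ; rewrite -{1}(oreprK α) => /ltoP[b ->] Sb.
have [c Sc cmin] := @wo_min _ [set c : orepr α | S (orank c)] (ex_intro _ b Sb).
exists (orank c) => // γ Sγ /lt_orankP[d dc E]; apply: (cmin d) dc.
by rewrite /= -E.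
Qed.

Lemma olt_asym (α β : Ord) : olt α β -> ~ olt β α.
Proof. by move=> h /(olt_trans h)/olt_irr. Qed.

Lemma oleNgt (α β : Ord) : ole α β <-> ~ olt β α.
Proof.
split=> [[/olt_asym//|->]|]; first exact: olt_irr.
by case: (olt_total α β) => [|->|]; [left|right|].
Qed.

(** * Ordinal addition and subtraction *)

Lemma oadd_otype (A B : woType) : oadd (otype A) (otype B) = otype (wo_sum A B).
Proof.
apply/otypeP.
have /asboolP[f [f' fK f'K] fP] : wo_iso (orepr (otype A)) A by apply/otypeP; rewrite oreprK.
have /asboolP[g [g' gK g'K] gP] : wo_iso (orepr (otype B)) B by apply/otypeP; rewrite oreprK.
pose h (u : wo_sum (orepr (otype A)) (orepr (otype B))) : wo_sum A B :=
  match u with inl x => inl (f x) | inr y => inr (g y) end.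
apply: (@wo_isoI _ _ h); first by move=> [x|x] [y|y] //=; [move/fP|move/gP].
by case=> y; [exists (inl (f' y))|exists (inr (g' y))]; rewrite /h /= ?f'K ?g'K.
Qed.

Lemma oaddA (α β γ : Ord) : oadd α (oadd β γ) = oadd (oadd α β) γ.
Proof.
rewrite -(oreprK α) -(oreprK β) -(oreprK γ) !oadd_otype; apply/otypeP.
pose h (u : wo_sum (orepr α) (wo_sum (orepr β) (orepr γ))) :
    wo_sum (wo_sum (orepr α) (orepr β)) (orepr γ) :=
  match u with inl x => inl (inl x) | inr (inl y) => inl (inr y) | inr (inr z) => inr z end.
apply: (@wo_isoI _ _ h); first by move=> [x|[x|x]] [y|[y|y]].
by move=> [[x|y]|z]; [exists (inl x)|exists (inr (inl y))|exists (inr (inr z))].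
Qed.

Lemma orank_inr (A B : woType) (b : B) :
  orank (inr b : wo_sum A B) = oadd (otype A) (orank b).
Proof.
rewrite /orank oadd_otype; apply/esym/otypeP.
pose h (u : wo_sum A (wo_seg b)) : wo_seg (inr b : wo_sum A B) :=
  match u with
  | inl x => exist (fun v : wo_sum A B => wo_lt v (inr b : wo_sum A B)) (inl x) I
  | inr y => exist (fun v : wo_sum A B => wo_lt v (inr b : wo_sum A B)) (inr (sval y)) (svalP y)
  end.
apply: (@wo_isoI (wo_sum A (wo_seg b)) (wo_seg (inr b : wo_sum A B)) h).
  by move=> [x|x] [y|y].
by move=> [[x|y] yb]; [exists (inl x)|exists (inr (exist _ y yb))]; apply: eq_exist.
Qed.

Lemma olt_add2l (α β γ : Ord) : olt β γ -> olt (oadd α β) (oadd α γ).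
Proof.
rewrite -(oreprK α) -(oreprK γ) => /ltoP[c ->].
by rewrite -orank_inr oadd_otype; apply/ltoP; exists (inr c).
Qed.

Lemma olt_add2lE (α β γ : Ord) : olt (oadd α β) (oadd α γ) <-> olt β γ.
Proof.
split=> [|/(olt_add2l α)//]; case: (olt_total β γ) => // [->/olt_irr//|].
by move=> /(olt_add2l α)/olt_asym.
Qed.

Lemma oadd_inj (α : Ord) : injective (oadd α).
Proof.
by move=> β γ E; case: (olt_total β γ) => // /(olt_add2l α); rewrite E => /olt_irr.
Qed.

Lemma wo_void : strict_well_order [set: void] (fun _ _ => False).
Proof. by split => [[]|[]|[]|[]|S _ [[]]]. Qed.

Definition ozero : Ord := otype (WoType wo_void).

Lemma oadd0 (α : Ord) : oadd α ozero = α.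
Proof.
rewrite -(oreprK α) oadd_otype; apply/esym/otypeP.
by apply: (@wo_isoI _ (wo_sum _ (WoType wo_void)) inl) => // -[x|[]]; exists x.
Qed.

Lemma ole0 (α : Ord) : ole ozero α.
Proof. by apply/oleNgt => /ltoP[[]]. Qed.

Lemma ole_addr (α β : Ord) : ole α (oadd α β).
Proof.
rewrite -[X in ole X](oadd0 α); case: (ole0 β) => [h|->]; [left|by right].
exact: olt_add2l.
Qed.

(** The type of this final segment is the difference of ordinals in [ole_subr]. *)
Lemma wo_cosegP (A : woType) (a : A) :
  strict_well_order [set: {x : A | ~ wo_lt x a}] (fun x y => wo_lt (sval x) (sval y)).
Proof.
split => // [x|x y z|x y _ _|S _ [s Ss]]; first exact: wo_irr.
- exact: wo_trans.
- case: (wo_total (sval x) (sval y)) => h; [constructor 1|constructor 2|constructor 3] => //.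
  by case: x y h => x xP [y yP] /= h; apply: eq_exist.
- have [|_ [x Sx <-] xmin] := @wo_min A (sval @` S); first by exists (sval s), s.
  by exists x => // y Sy; apply: xmin; exists y.
Qed.

Lemma ole_subr (α β : Ord) : ole α β -> exists γ, oadd α γ = β.
Proof.
case=> [|->]; last by exists ozero; exact: oadd0.
rewrite -(oreprK β) => /ltoP[b ->]; exists (otype (WoType (wo_cosegP b))).
rewrite oadd_otype; apply/otypeP.
pose h (u : wo_sum (wo_seg b) (WoType (wo_cosegP b))) : orepr β :=
  match u with inl x => sval x | inr y => sval y end.
apply: (@wo_isoI _ _ h).
  move=> [x|x] [y|y] //= _; apply: wo_lt_le_trans (svalP x) (svalP y).
move=> y; have [yb|nyb] := pselect (wo_lt y b).
  by exists (inl (exist _ y yb)).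
by exists (inr (exist _ y nyb)).
Qed.

Lemma ole_lt_trans (α β γ : Ord) : ole α β -> olt β γ -> olt α γ.
Proof. by case=> [h /(olt_trans h)|->]. Qed.

Lemma oadd0l (α : Ord) : oadd ozero α = α.
Proof.
rewrite -(oreprK α) oadd_otype; apply/esym/otypeP.
by apply: (@wo_isoI _ (wo_sum (WoType wo_void) _) inr) => // -[[]|x]; exists x.
Qed.

(** * Tails *)

Section Tails.
Variable P : Type.
Implicit Types (σ τ ρ : oseq P) (β γ δ : Ord).

Lemma oval_eq σ γ γ' (h : olt γ (olen σ)) (h' : olt γ' (olen σ)) :
  γ = γ' -> oval (exist _ γ h) = oval (exist _ γ' h').
Proof. by move=> E; congr oval; apply: eq_exist. Qed.

Lemma tail_exists σ β : ole β (olen σ) -> exists τ, is_tail σ β τ.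
Proof.
move=> /ole_subr[δ E].
have lt γ : olt γ δ -> olt (oadd β γ) (olen σ) by rewrite -E => /(olt_add2l β).
exists (OSeq (fun g : {γ | olt γ δ} =>
  oval (exist (fun γ => olt γ (olen σ)) _ (lt _ (svalP g))))).
by split=> //= γ hγ hβγ; apply: oval_eq.
Qed.

Lemma tail_uniq σ β τ ρ : is_tail σ β τ -> is_tail σ β ρ -> τ = ρ.
Proof.
case: τ ρ => [l v] [l' v'] [/= E H] [/= E' H'].
have ll' : l = l' by apply: (@oadd_inj β); rewrite E.
case: _ / ll' in v' E' H' *; congr OSeq; apply/funext => -[γ hγ].
have hβγ : olt (oadd β γ) (olen σ) by rewrite -E; exact: olt_add2l.
by rewrite (H _ _ hβγ) (H' _ _ hβγ).
Qed.

Lemma tail_refl σ : is_tail σ ozero σ.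
Proof.
split=> [|γ hτ hσ]; first exact: oadd0l.
by apply: oval_eq; rewrite oadd0l.
Qed.

Lemma tail_comp σ τ ρ β γ :
  is_tail σ β τ -> is_tail τ γ ρ -> is_tail σ (oadd β γ) ρ.
Proof.
move=> [E H] [E' H']; split=> [|δ hρ hσ]; first by rewrite -oaddA E' E.
have hτ : olt (oadd γ δ) (olen τ) by rewrite -E'; exact: olt_add2l.
have hσ' : olt (oadd β (oadd γ δ)) (olen σ) by rewrite oaddA.
by rewrite (H' _ _ hτ) (H _ _ hσ'); apply: oval_eq; rewrite oaddA.
Qed.

Lemma tail_sub σ τ ρ β γ :
  is_tail σ β τ -> is_tail σ (oadd β γ) ρ -> is_tail τ γ ρ.
Proof.
move=> [E H] [E' H']; split=> [|δ hρ hτ].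
  by apply: (@oadd_inj β); rewrite oaddA E' E.
have hσ : olt (oadd β (oadd γ δ)) (olen σ) by rewrite -E; exact: olt_add2l.
have hσ' : olt (oadd (oadd β γ) δ) (olen σ) by rewrite -oaddA.
by rewrite (H' _ _ hσ') (H _ _ hσ); apply: oval_eq; rewrite oaddA.
Qed.

Lemma rank_exists σ τ β : is_tail σ β τ -> exists2 γ, is_rank σ τ γ & ole γ β.
Proof.
move=> t; have [γ tγ γmin] := @olt_min [set γ | is_tail σ γ τ] (ex_intro _ β t).
exists γ; first by split=> // δ /γmin /oleNgt.
exact/oleNgt/γmin.
Qed.

Lemma rank_uniq σ τ β γ : is_rank σ τ β -> is_rank σ τ γ -> β = γ.
Proof.
move=> [tβ mβ] [tγ mγ]; have := mβ _ tγ; have /oleNgt := mγ _ tβ.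
by move=> nβγ [].
Qed.

Lemma rank_inj σ τ ρ β : is_rank σ τ β -> is_rank σ ρ β -> τ = ρ.
Proof. by move=> [t _] [r _]; exact: tail_uniq t r. Qed.

Lemma tail_order_lt (W : set (oseq P)) σ τ ρ β γ :
  W σ -> W τ -> W ρ -> is_rank σ τ β -> is_rank σ ρ γ -> olt β γ ->
  tail_order W σ τ ρ.
Proof. by move=> Wσ Wτ Wρ rτ rρ lt; split=> //; exists β, γ. Qed.

Lemma rank_self σ : is_rank σ σ ozero.
Proof. by split=> [|γ _]; [exact: tail_refl|exact: ole0]. Qed.

(** Ranks map the tails of σ injectively to ordinals, which yields the well-order; σ has rank zero
    in itself, which yields centering. *)
Lemma tail_order_frame (W : set (oseq P)) :
  W !=set0 -> order_frame W (tail_order W).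
Proof.
move=> W0; split=> // [σ Wσ|σ τ ρ Wσ [[Wτ _ _] [β [_ [rτ _ _]]]]]; last first.
  have [E|lt] := ole0 β; last by left; apply: rank_inj (rank_self σ) _; rewrite lt.
  by right; apply: tail_order_lt (rank_self σ) rτ E.
exists [set τ | W τ /\ exists β, is_tail σ β τ]; first by move=> τ [].
split=> [τ ρ [[Wτ Wρ _] [β [γ [rτ rρ _]]]]|τ|x y z|τ ρ|S SD [s Ss]].
- by split; split=> //; [exists β; case: rτ|exists γ; case: rρ].
- by move=> [_ [β [γ [rτ rτ']]]]; rewrite (rank_uniq rτ rτ') => /olt_irr.
- move=> [[Wx Wy Wσ'] [a [b [ra rb ab]]]] [[_ Wz _] [b' [c [rb' rc bc]]]].
  apply: tail_order_lt ra rc _ => //; apply: olt_trans ab _.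
  by rewrite (rank_uniq rb rb').
- move=> [Wτ [β /rank_exists[b rτ _]]] [Wρ [γ /rank_exists[c rρ _]]].
  case: (olt_total b c) => [h|h|h].
  + by constructor 1; apply: tail_order_lt rτ rρ h.
  + by constructor 2; apply: rank_inj rτ _; rewrite h.
  + by constructor 3; apply: tail_order_lt rρ rτ h.
- have [|b [t [St rt]] bmin] := @olt_min [set b | exists t, S t /\ is_rank σ t b].
    by have [_ [β /rank_exists[b rs _]]] := SD _ Ss; exists b, s.
  exists t => // y Sy yt; have [[Wy _ _] [c [d [ry rt' cd]]]] := yt.
  by apply: (bmin c); [exists y|rewrite (rank_uniq rt rt')].
Qed.

End Tails.

(** * Truth in tail frames *)

Section TailSemantics.
Variables (P : Type) (W : set (oseq P)) (V : nat -> oseq P -> bool).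
Implicit Types (σ τ ρ : oseq P) (β γ δ : Ord) (p q r : sentence).

Local Notation D := (denot W (tail_order W) V).

(** Indices replace ranks, since the least index of a [p]-tail is also the rank of that tail.
    Membership in [W] is implied by [D p τ]. *)
Definition first_tail p σ β τ :=
  [/\ is_tail σ β τ, D p τ & forall γ ρ, olt γ β -> is_tail σ γ ρ -> ~ D p ρ].

Lemma denotW p σ : D p σ -> W σ.
Proof. by elim: p => [k|p _|p IH q _|p _ q _] [] // /IH. Qed.

Lemma reach_tail σ τ : W σ -> reach (tail_order W) σ τ ->
  W τ /\ exists β, is_rank σ τ β.
Proof.
move=> Wσ [->|[[_ Wτ _] [_ [γ [_ rτ _]]]]]; last by split=> //; exists γ.
by split=> //; exists ozero; exact: rank_self.
Qed.

Lemma tail_reach σ τ β : W σ -> W τ -> is_tail σ β τ -> reach (tail_order W) σ τ.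
Proof.
move=> Wσ Wτ /rank_exists[γ rτ _]; case: (ole0 γ) => [h|h].
  by right; apply: tail_order_lt (rank_self σ) rτ h.
by left; apply: rank_inj rτ _; rewrite -h; exact: rank_self.
Qed.

Lemma first_tail_uniq p σ β τ γ ρ :
  first_tail p σ β τ -> first_tail p σ γ ρ -> β = γ /\ τ = ρ.
Proof.
move=> [tτ pτ mτ] [tρ pρ mρ]; have E : β = γ.
  by case: (olt_total β γ) => // h; [case: (mρ _ _ h tτ)|case: (mτ _ _ h tρ)].
by split=> //; move: tρ; rewrite -E; exact: tail_uniq.
Qed.

Lemma first_tail_exists p σ :
  (forall β τ, is_tail σ β τ -> ~ D p τ) \/ exists β τ, first_tail p σ β τ.
Proof.
have [[β [τ [t pτ]]]|no] := pselect (exists β τ, is_tail σ β τ /\ D p τ); last first.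
  by left=> β τ t pτ; apply: no; exists β, τ.
right; have [|γ [ρ [tρ pρ]] γmin] :=
    @olt_min [set β | exists τ, is_tail σ β τ /\ D p τ]; first by exists β, τ.
by exists γ, ρ; split=> // δ χ δγ tχ pχ; apply: (γmin δ) => //; exists χ.
Qed.

Lemma denot_cond_none p q σ : W σ ->
  (forall β τ, is_tail σ β τ -> ~ D p τ) -> D (p ▷ q)%cond σ.
Proof.
move=> Wσ no; split=> //; left; apply/seteqP; split=> // τ [/reach_tail[]// Wτ [β [t _]]].
exact: no t.
Qed.

Lemma denot_cond_first p q σ β τ : W σ -> first_tail p σ β τ ->
  D (p ▷ q)%cond σ <-> D q τ.
Proof.
move=> Wσ fτ; have [t pτ mτ] := fτ; have Wτ := denotW pτ.
have rτ : is_rank σ τ β.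
  by split=> // γ tγ; apply/oleNgt => h; apply: mτ h tγ pτ.
split=> [[_ [E|[y [[ry py] qy] ymin]]]|qτ].
- by have : set0 τ by rewrite -E; split=> //; exact: tail_reach t.
- have [Wy [γ ryγ]] := reach_tail Wσ ry.
  suff fy : first_tail p σ γ y by have [_ ->] := first_tail_uniq fτ fy.
  split=> [||δ ρ δγ tρ pρ] //; first by case: ryγ.
  have [ε rρ εδ] := rank_exists tρ; have Wρ := denotW pρ; apply: (ymin ρ) pρ.
  exact: tail_order_lt rρ ryγ (ole_lt_trans εδ δγ).
- split=> //; right; exists τ; first by split=> //; split=> //; exact: tail_reach t.
  move=> x [_ [γ [δ [[tγ _] rδ lt]]]]; apply: mτ tγ.
  by rewrite (rank_uniq rτ rδ).
Qed.

Lemma denotN p σ : W σ -> D (¬ p)%cond σ <-> ~ D p σ.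
Proof. by move=> Wσ; split=> [[]|]. Qed.

Lemma denotI p q σ : W σ -> D (p → q)%cond σ <-> (D p σ -> D q σ).
Proof.
move=> Wσ; split=> [[_ npq] pσ|pq]; first by apply: contrapT => nq; apply: npq.
by split=> // -[pσ [_]]; apply; exact: pq.
Qed.

Lemma denot_box p σ : W σ ->
  D (□ p)%cond σ <-> forall β τ, is_tail σ β τ -> W τ -> D p τ.
Proof.
move=> Wσ; have [no|[β [τ fτ]]] := first_tail_exists (¬ p)%cond σ.
  split=> [_ β τ t Wτ|_]; last exact: denot_cond_none.
  by apply: contrapT => np; apply: (no _ _ t); split.
rewrite (denot_cond_first _ Wσ fτ); have [t [Wτ np] _] := fτ.
by split=> // /(_ _ _ t Wτ).
Qed.

(** * Soundness *)

Lemma sound_C2 p σ : W σ -> C2_axiom p -> D p σ.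
Proof.
move=> Wσ [a s taut|{}p|{}p q r|{}p q|{}p q].
- suff E : D (psubst s a) σ <-> peval (fun n => `[< D (s n) σ >]) a by apply/E/taut.
  elim: a {taut} => [n|a IH|a IHa b IHb]; first by split=> [?|/asboolP//]; apply/asboolP.
    by rewrite (denotN _ Wσ) IH; split=> /negP.
  by split=> [[/IHa/= -> /IHb ->]//|/andP[/IHa ? /IHb ?]].
- case: (first_tail_exists p σ) => [no|[β [τ fτ]]]; first exact: denot_cond_none.
  by apply/(denot_cond_first _ Wσ fτ); case: fτ.
- apply/(denotI _ _ Wσ) => -[[pq qp] pr].
  case: (first_tail_exists q σ) => [no|[β [τ fτ]]]; first exact: denot_cond_none.
  apply/(denot_cond_first _ Wσ fτ).
  have pτ : D p τ by apply/(denot_cond_first _ Wσ fτ).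
  case: (first_tail_exists p σ) => [no|[γ [ρ fρ]]]; first by case: fτ => /no.
  have qρ : D q ρ by apply/(denot_cond_first _ Wσ fρ).
  suff -> : τ = ρ by apply/(denot_cond_first _ Wσ fρ).
  (* Both tails satisfy [p] and [q], so neither index can precede the other. *)
  have [tτ qτ mτ] := fτ; have [tρ pρ mρ] := fρ.
  suff E : β = γ by move: tρ; rewrite -E; exact: tail_uniq.
  by case: (olt_total β γ) => // h; [case: (mρ _ _ h tτ)|case: (mτ _ _ h tρ)].
- apply/(denotI _ _ Wσ) => pq; apply/(denotI _ _ Wσ) => pσ.
  have fσ : first_tail p σ ozero σ.
    by split=> //; [exact: tail_refl|move=> γ ρ h; case: ((oleNgt _ _).1 (ole0 γ) h)].
  exact/(denot_cond_first _ Wσ fσ).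
- suff : D (p ▷ q)%cond σ \/ D (p ▷ ¬ q)%cond σ.
    by move=> h; split=> // -[[_ n1] [_ n2]]; case: h.
  case: (first_tail_exists p σ) => [no|[β [τ fτ]]]; first by left; exact: denot_cond_none.
  rewrite !(denot_cond_first _ Wσ fτ) denotN; first exact: EM.
  by case: fτ => _ /denotW.
Qed.

(** No tail satisfying both [p] and [q] precedes the first [p]-tail τ of σ. Hence the first such
    tail of σ is the first such tail of τ, with its index shifted by β. *)
Lemma sound_flattening p σ : W σ -> flattening p -> D p σ.
Proof.
move=> Wσ []{}p q r; set pq := (p ∧ q)%cond.
suff E : D (p ▷ (pq ▷ r))%cond σ <-> D (pq ▷ r)%cond σ.
  by split; apply/(denotI _ _ Wσ); rewrite E.
case: (first_tail_exists p σ) => [no|[β [τ fτ]]].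
  split=> _; apply: denot_cond_none => //.
  by move=> β τ /no np [].
rewrite (denot_cond_first _ Wσ fτ); have [t pτ mτ] := fτ; have Wτ := denotW pτ.
have after γ ρ : is_tail σ γ ρ -> D pq ρ ->
    exists2 δ, oadd β δ = γ & is_tail τ δ ρ.
  move=> tρ [pρ _]; have /ole_subr[δ E] : ole β γ.
    by apply/oleNgt => h; apply: mτ h tρ pρ.
  by exists δ => //; apply: tail_sub t _; rewrite E.
case: (first_tail_exists pq τ) => [no|[δ [ρ fρ]]].
  split=> _; apply: denot_cond_none => // γ ρ tρ pqρ.
  by have [δ _ /no] := after _ _ tρ pqρ.
have fσ : first_tail pq σ (oadd β δ) ρ.
  have [tρ pρ mρ] := fρ; split=> // [|γ χ h tχ pχ]; first exact: tail_comp t tρ.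
  have [ε E tχ'] := after _ _ tχ pχ.
  by apply: mρ tχ' pχ; move: h; rewrite -E => /olt_add2lE.
by rewrite (denot_cond_first _ Wτ fρ) (denot_cond_first _ Wσ fσ).
Qed.

(** Truth is proved at all points at once because Normality uses its premise at the first
    [s]-tail. *)
Lemma sound_closure (A : set sentence) p :
  (forall q σ, A q -> W σ -> D q σ) -> Defs.closure A p -> forall σ, W σ -> D p σ.
Proof.
move=> HA; elim=> {p} [p Ap σ|p q _ IHpq _ IHp σ Wσ|p q r s _ IH σ Wσ].
- exact: HA.
- by move: (IHpq σ Wσ) (IHp σ Wσ) => /(denotI _ _ Wσ).
apply/(denotI _ _ Wσ) => -[sp sq].
case: (first_tail_exists s σ) => [no|[β [τ fτ]]]; first exact: denot_cond_none.
have Wτ : W τ by case: fτ => _ /denotW.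
apply/(denot_cond_first _ Wσ fτ); move: (IH τ Wτ) => /(denotI _ _ Wτ); apply.
by split; apply/(denot_cond_first _ Wσ fτ).
Qed.

End TailSemantics.

Lemma sound_mckinsey (P : Type) (W : set (oseq P)) (V : nat -> oseq P -> bool) p σ :
  final_ordinal_sequence_frame W -> W σ -> mckinsey p ->
  denot W (tail_order W) V p σ.
Proof.
move=> [_ fin] Wσ []{}p; apply/(denotI _ _ _ Wσ) => /(denot_box _ _ Wσ) bd.
have [β [τ [t Wτ τfin]]] := fin _ Wσ; apply/(denotN _ _ Wσ) => /(denot_box _ _ Wσ).
move=> /(_ _ _ t Wτ)/(denotN _ _ Wτ); apply; apply/(denot_box _ _ Wτ).
have stay γ ρ : is_tail τ γ ρ -> W ρ -> ρ = τ.
  by move=> /(tail_comp t); apply: τfin; exact: ole_addr.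
move=> γ ρ /stay tρ /tρ ->; have /(denotN _ _ Wτ) := bd _ _ t Wτ.
rewrite (denot_box _ _ Wτ) => nb; apply: contrapT => np.
by apply: nb => γ' ρ' /stay tρ' /tρ' ->; apply/(denotN _ _ Wτ).
Qed.

Lemma soundness p : C2FM p -> forall (P : Type) (W : set (oseq P)),
  final_ordinal_sequence_frame W -> frame_valid W (tail_order W) p.
Proof.
move=> Lp P W fin V σ; apply: sound_closure Lp σ.
move=> {}p σ [Lp|mp] Wσ; last exact: sound_mckinsey.
apply: sound_closure Lp σ Wσ => {}p σ [Lp|fp] Wσ; last exact: sound_flattening.
by apply: sound_closure Lp σ Wσ => {}p σ ap Wσ; exact: sound_C2.
Qed.

(** * Maximal consistent sets *)

(** This coding makes sentences countable, so that [skeleton] can number atoms and conditionals as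
    propositional variables. *)
Fixpoint sentence_tree (p : sentence) : GenTree.tree nat :=
  match p with
  | Atom k => GenTree.Leaf k
  | Neg p => GenTree.Node 0 [:: sentence_tree p]
  | And p q => GenTree.Node 1 [:: sentence_tree p; sentence_tree q]
  | Cond p q => GenTree.Node 2 [:: sentence_tree p; sentence_tree q]
  end.

Fixpoint tree_sentence (t : GenTree.tree nat) : option sentence :=
  match t with
  | GenTree.Leaf k => Some (Atom k)
  | GenTree.Node 0 [:: t] => omap Neg (tree_sentence t)
  | GenTree.Node n [:: t; u] =>
      match tree_sentence t, tree_sentence u with
      | Some p, Some q => Some (if n == 1 then And p q else Cond p q)
      | _, _ => None
      end
  | _ => None
  end.

Lemma sentence_treeK : pcancel sentence_tree tree_sentence.
Proof. by elim=> //= [p ->|p -> q ->|p -> q ->]. Qed.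

HB.instance Definition _ := Countable.copy sentence (pcan_type sentence_treeK).

Definition boolean (v : sentence -> bool) : Prop :=
  (forall p, v (¬ p)%cond = ~~ v p) /\
  (forall p q, v (p ∧ q)%cond = v p && v q).

Fixpoint skeleton (p : sentence) : pform :=
  match p with
  | Neg p => PNeg (skeleton p)
  | And p q => PAnd (skeleton p) (skeleton q)
  | p => PVar (pickle p)
  end.

Lemma skeletonK p : psubst (fun n => odflt (Atom 0) (unpickle n)) (skeleton p) = p.
Proof. by elim: p => [k|p /= ->|p /= -> q ->|p _ q _] //=; rewrite pickleK. Qed.

Lemma thm_C2F p : C2F p -> C2FM p.
Proof. by move=> h; apply: closure_base; left. Qed.

Lemma thm_axiom p : C2_axiom p -> C2FM p.
Proof.
by move=> h; apply: thm_C2F; apply: closure_base; left; apply: closure_base.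
Qed.

Lemma thm_flattening p : flattening p -> C2FM p.
Proof. by move=> h; apply: thm_C2F; apply: closure_base; right. Qed.

Lemma thm_mckinsey p : mckinsey p -> C2FM p.
Proof. by move=> h; apply: closure_base; right. Qed.

Lemma thm_taut p : (forall v, boolean v -> v p) -> C2FM p.
Proof.
move=> taut; rewrite -(skeletonK p); apply/thm_axiom/C2_PC => v.
by have := taut (fun q => peval v (skeleton q)); apply; split.
Qed.

Ltac taut :=
  let v := fresh in let N := fresh in let A := fresh in
  apply: thm_taut; intros v [N A];
  rewrite /Imp /Or ?(N, A);
  repeat match goal with |- context [v ?p] => case: (v p) => // end.

Record mcs (G : set sentence) : Prop := {
  mcs_thm : forall p, C2FM p -> G p;
  mcs_mp : forall p q, G (p → q)%cond -> G p -> G q;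
  mcsN : forall p, G (¬ p)%cond <-> ~ G p }.

Lemma lindenbaum p : ~ C2FM p -> exists2 G, mcs G & ~ G p.
Proof.
move=> np.
pose th (G : set sentence) := [/\ C2FM `<=` G,
  forall q r, G (q → r)%cond -> G q -> G r & ~ G p].
have thC : th C2FM by split=> // q r; exact: closure_detachment.
have [F FP Ftot|G [PG Gmax]] := @Zorn_bigcup _ [set G | G = set0 \/ th G].
  have [[G0 [FG0 thG0]]|no] := pselect (exists G, F G /\ th G); last first.
    left; apply/seteqP; split=> // q [G FG Gq].
    have [E|thG] := FP _ FG; first by rewrite E in Gq.
    by case: no; exists G.
  right; split=> [q Lq|q r [G FG Gqr] [H FH Hq]|[G FG Gp]].
  - by exists G0 => //; case: thG0 => + _ _; apply.
  - have up K : F K -> K (q → r)%cond -> K q -> exists2 K, F K & K r.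
      by move=> FK Kqr Kq; have [E|[_ mp _]] := FP _ FK;
        [rewrite E in Kq|exists K => //; exact: mp Kqr Kq].
    by have [GH|HG] := Ftot _ _ FG FH; [apply: (up H); auto|apply: (up G); auto].
  - by have [E|[_ _]] := FP _ FG; [rewrite E in Gp|apply].
have {PG}thG : th G.
  case: PG => // E; case: (Gmax C2FM); last by right.
  rewrite E; split=> // sub; apply: (sub (Atom 0 ▷ Atom 0)%cond).
  exact/thm_axiom/C2_Identity.
have [sub mp nGp] := thG.
(* The set of all [r] with [G (q → r)] is a theory containing [G] and [q]; if it omitted [p], it
   would contradict maximality. *)
have max q : ~ G q -> G (q → p)%cond.
  move=> nq; apply: contrapT => nqp; apply: (Gmax [set r | G (q → r)%cond]); last first.
    right; split=> // [r Lr|r s Gqrs Gqr].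
      have Gr : G r := sub _ Lr.
      by apply: (mp) Gr; apply: (sub); taut.
    by apply: (mp) Gqr; apply: (mp) Gqrs; apply: (sub); taut.
  split=> [r Gr|E]; last by apply: nq; apply: E; apply: (sub); taut.
  by apply: (mp) Gr; apply: (sub); taut.
exists G => //; split=> // q; split=> [Gnq Gq|nGq].
  by apply: nGp; apply: (mp) Gq; apply: (mp) Gnq; apply: (sub); taut.
apply: contrapT => /max Gnqp; apply: nGp.
by apply: (mp) (max _ nGq); apply: (mp) Gnqp; apply: (sub); taut.
Qed.

Lemma thm_mcs p : (forall G, mcs G -> G p) -> C2FM p.
Proof. by move=> h; apply: contrapT => /lindenbaum[G /h]. Qed.

Lemma mcsA G p q : mcs G -> G (p ∧ q)%cond <-> G p /\ G q.
Proof.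
move=> mG; split=> [Gpq|[Gp Gq]].
  by split; apply: (mcs_mp mG) Gpq; apply: (mcs_thm mG); taut.
by apply: (mcs_mp mG) Gq; apply: (mcs_mp mG) Gp; apply: (mcs_thm mG); taut.
Qed.

Lemma mcsI G p q : mcs G -> G (p → q)%cond <-> (G p -> G q).
Proof.
move=> mG; rewrite (mcsN mG) (mcsA _ _ mG) (mcsN mG).
split=> [npq Gp|pq [Gp]]; last by apply; exact: pq.
by apply: contrapT => nq; apply: npq.
Qed.

Lemma mcsO G p q : mcs G -> G (p ∨ q)%cond <-> G p \/ G q.
Proof.
move=> mG; rewrite (mcsN mG) (mcsA _ _ mG) !(mcsN mG).
split=> [npq|pq [np nq]]; last by case: pq.
by have [Gp|np] := EM (G p); [left|right; apply: contrapT => nq; apply: npq].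
Qed.

Lemma mcs_axiom G p : mcs G -> C2_axiom p -> G p.
Proof. by move=> mG h; apply/(mcs_thm mG)/thm_axiom. Qed.

(** * Conditionals in a maximal consistent set *)

Section MCS.
Variables (G : set sentence) (mG : mcs G).
Implicit Types p q r f g : sentence.

Lemma cond_mono2 f p q r : (forall D, mcs D -> D p -> D q -> D r) ->
  G (f ▷ p)%cond -> G (f ▷ q)%cond -> G (f ▷ r)%cond.
Proof.
move=> pqr fp fq; have : G ((f ▷ p) ∧ (f ▷ q))%cond by apply/(mcsA _ _ mG).
apply/(mcsI _ _ mG)/(mcs_thm mG)/closure_normality/thm_mcs => D mD.
by apply/(mcsI _ _ mD) => /(mcsA _ _ mD)[]; exact: pqr.
Qed.

Lemma cond_mono f p q : (forall D, mcs D -> D p -> D q) ->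
  G (f ▷ p)%cond -> G (f ▷ q)%cond.
Proof. by move=> pq fp; apply: cond_mono2 (fp) (fp) => D mD Dp _; exact: pq. Qed.

Lemma cond_id f : G (f ▷ f)%cond.
Proof. exact/(mcs_axiom mG)/C2_Identity. Qed.

Lemma cond_imp f p : (forall D, mcs D -> D f -> D p) -> G (f ▷ p)%cond.
Proof. by move=> h; apply: cond_mono (cond_id f). Qed.

Lemma cond_recip p q r :
  G (p ▷ q)%cond -> G (q ▷ p)%cond -> G (p ▷ r)%cond -> G (q ▷ r)%cond.
Proof.
move=> pq qp pr.
have : G ((p ▷ q) ∧ (q ▷ p) ∧ (p ▷ r) → (q ▷ r))%cond.
  exact/(mcs_axiom mG)/C2_Reciprocity.
by move=> /(mcsI _ _ mG); apply; rewrite !(mcsA _ _ mG).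
Qed.

Lemma cond_cem p q : G (p ▷ q)%cond \/ G (p ▷ ¬ q)%cond.
Proof. exact/(mcsO _ _ mG)/(mcs_axiom mG)/C2_CEM. Qed.

Lemma cond_congr f g q : (forall D, mcs D -> D f <-> D g) ->
  G (f ▷ q)%cond <-> G (g ▷ q)%cond.
Proof.
by move=> fg; split; apply: cond_recip; apply: cond_imp => D mD /(fg D mD).
Qed.

Lemma cond_mp p q : G (p ▷ q)%cond -> G p -> G q.
Proof.
by move=> pq; apply/(mcsI _ _ mG); move: pq; apply/(mcsI _ _ mG)/(mcs_axiom mG)/C2_MP.
Qed.

Lemma cond_center p q : G p -> G (p ▷ q)%cond <-> G q.
Proof.
move=> Gp; split=> [/cond_mp/(_ Gp)//|Gq]; have [//|/cond_mp/(_ Gp)] := cond_cem p q.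
by rewrite (mcsN mG).
Qed.

End MCS.

(** * Nearest points, necessity and accessibility *)

Section MCS2.
Variables (G : set sentence) (mG : mcs G).
Implicit Types p q r f g : sentence.

(** When [g] entails [f], the conjunction [f ∧ g] is equivalent to [g] and may be replaced by it in
    Flattening. *)
Lemma cond_flat f g q : (forall D, mcs D -> D g -> D f) ->
  G (f ▷ (g ▷ q))%cond <-> G (g ▷ q)%cond.
Proof.
move=> gf; have gE D : mcs D -> D (f ∧ g)%cond <-> D g.
  by move=> mD; rewrite (mcsA _ _ mD); split=> [[]|Dg] //; split=> //; exact: gf.
rewrite -(cond_congr mG q gE).
have : G ((f ▷ ((f ∧ g) ▷ q)) ↔ ((f ∧ g) ▷ q))%cond.
  exact/(mcs_thm mG)/thm_flattening.
move=> /(mcsA _ _ mG)[/(mcsI _ _ mG) h1 /(mcsI _ _ mG) h2].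
have E : G (f ▷ (g ▷ q))%cond <-> G (f ▷ ((f ∧ g) ▷ q))%cond.
  by split; apply: cond_mono => // D mD /(cond_congr mD q gE).
by rewrite E.
Qed.

Definition near f : set sentence := [set q | G (f ▷ q)%cond].

Lemma mcs_near f : ~ G (f ▷ ¬ f)%cond -> mcs (near f).
Proof.
move=> nf; split=> [p Lp|p q Gpq Gp|p].
- by apply: cond_imp => // D mD _; exact: (mcs_thm mD).
- by apply: (cond_mono2 mG) Gpq Gp => D mD; exact: (mcs_mp mD).
split=> [np fp|]; last by case: (cond_cem mG f p).
by apply: nf; apply: (cond_mono2 mG) np fp => D mD /(mcsN mD).
Qed.

(** Since [f] is impossible, [f ▷ p] holds. Were [p ▷ f] true as well, Reciprocity would turn
    [f ▷ ¬ f] into [p ▷ ¬ f]. *)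
Lemma cond_neg_box f p : G (f ▷ ¬ f)%cond -> G (p ▷ ¬ f)%cond.
Proof.
move=> fnf; have fp : G (f ▷ p)%cond.
  by apply: (cond_mono2 mG) fnf (cond_id mG f) => D mD /(mcsN mD).
have [//|pnnf] := cond_cem mG p (¬ f)%cond; apply: (cond_recip mG) fp _ fnf.
by apply: (cond_mono mG) pnnf => D mD /(mcsN mD); rewrite (mcsN mD) => /contrapT.
Qed.

Lemma boxN f : G (□ ¬ f)%cond <-> G (f ▷ ¬ f)%cond.
Proof.
by apply: (cond_congr mG) => D mD; rewrite !(mcsN mD); split=> [/contrapT|? []].
Qed.

Lemma box_cond p f : G (□ p)%cond -> G (f ▷ p)%cond.
Proof.
move=> bp; have : G (f ▷ ¬ ¬ p)%cond.
  apply: cond_neg_box; apply: (cond_mono mG) bp => D mD.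
  by rewrite !(mcsN mD) => Dp [].
by apply: (cond_mono mG) => D mD; rewrite !(mcsN mD) => /contrapT.
Qed.

Definition sees (D : set sentence) : Prop := forall p, G (□ p)%cond -> D p.

Lemma not_box p : ~ G (□ p)%cond -> exists D, [/\ mcs D, sees D & ~ D p].
Proof.
move=> nb; exists (near (¬ p)%cond); split=> //; last by move=> q; exact: box_cond.
apply: mcs_near => npp; apply: nb; apply: (cond_mono mG) npp => D mD.
by rewrite !(mcsN mD) => /contrapT.
Qed.

Lemma sees_refl : sees G.
Proof.
move=> p bp; apply: contrapT => np; apply: (np); apply: (cond_mp mG) bp _.
by apply/(mcsN mG).
Qed.

(** The S4 axiom. The nearest point where [□ p] or [p] fails satisfies [p], so by Reciprocity it is
    also the nearest point where [□ p] fails; yet Flattening makes [¬ p ▷ p] true there. *)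
Lemma box_box p : G (□ p)%cond -> G (□ □ p)%cond.
Proof.
move=> bp; set f := (¬ □ p)%cond; set g := (f ∨ ¬ p)%cond.
have gf : G (g ▷ f)%cond.
  apply: (cond_mono2 mG) (cond_id mG g) (box_cond g bp) => D mD.
  by rewrite (mcsO _ _ mD) (mcsN mD (p)) => -[].
have fg : G (f ▷ g)%cond by apply: cond_imp => // D mD Df; apply/(mcsO _ _ mD); left.
apply: (cond_recip mG) gf fg _; apply/(cond_flat _ _) => // D mD Dnp.
by apply/(mcsO _ _ mD); right.
Qed.

End MCS2.

Lemma sees_trans G D E : mcs G -> sees G D -> sees D E -> sees G E.
Proof. by move=> mG GD DE p bp; apply: DE; apply: GD; exact: box_box. Qed.

Definition decides (G : set sentence) (p : sentence) : Prop :=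
  G (□ p)%cond \/ G (□ ¬ p)%cond.

(** Sentences are decided one at a time; by [box_box], earlier decisions persist along [sees]. *)
Lemma mckinsey_decides (l : seq sentence) G : mcs G ->
  exists D, [/\ mcs D, sees G D & forall p, p \in l -> decides D p].
Proof.
move=> mG; elim: l => [|p l [D [mD GD dD]]]; first by exists G; split=> //; exact: sees_refl.
have [E [mE DE dE]] : exists E, [/\ mcs E, sees D E & decides E p].
  have [dbp|ndbp] := EM (D (◇ □ p)%cond).
    move: dbp => /(mcsN mD)/(not_box mD)[E [mE DE]].
    by rewrite (mcsN mE) => /contrapT bp; exists E; split=> //; left.
  have : ~ D (□ ◇ p)%cond.
    by apply: contra_not ndbp; exact/(mcsI _ _ mD)/(mcs_thm mD)/thm_mckinsey/McKinsey.
  move=> /(not_box mD)[E [mE DE]]; rewrite (mcsN mE) => /contrapT bp.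
  by exists E; split=> //; right.
exists E; split=> // [|q]; first exact: sees_trans GD DE.
rewrite inE => /predU1P[->//|/dD[] b]; [left|right]; exact/DE/(box_box mD).
Qed.

(** * The first uncountable ordinal *)

Lemma uncountable_powerset : ~ countable [set: nat -> bool].
Proof.
move=> /countable_injP[f finj].
pose X := fun n => `[< exists2 Y : nat -> bool, f Y = n & ~ Y n >].
have Xf : X (f X) <-> ~ X (f X).
  split=> [/asboolP[Y fYX nY]|nX]; last by apply/asboolP; exists X.
  by rewrite -{1}(finj _ _ (mem_setT Y) (mem_setT X) fYX).
have nX : ~ X (f X) by move=> h; exact: (Xf.1 h h).
exact: (nX (Xf.2 nX)).
Qed.

Lemma well_orderable (T : Type) : exists lt, strict_well_order [set: T] lt.
Proof.
have [R Rwo] := @well_ordering_principle {classic T}.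
have Rwo' : wo_chain R predT by move=> S _; exact: Rwo.
have Rxx x : R x x := wo_chain_reflexive Rwo' (isT : x \in predT).
have Ra x y : R x y -> R y x -> x = y.
  by move=> xy yx; apply: (wo_chain_antisymmetric Rwo') => //; rewrite xy.
have minP (S : set {classic T}) : S !=set0 ->
    exists2 x, S x & forall y, S y -> R x y.
  move=> [s Ss]; have [|x [[/asboolP Sx xmin] _]] := Rwo [pred x | `[< S x >]].
    by exists s; apply/asboolP.
  by exists x => // y Sy; apply: xmin; apply/asboolP.
have total x y : R x y \/ R y x.
  have [|z [->|->] zmin] := minP [set z | z = x \/ z = y]; first by exists x; left.
    by left; apply: zmin; right.
  by right; apply: zmin; left.
have trans x y z : R x y -> R y z -> R x z.
  have [|t h tmin] := minP [set t | [\/ t = x, t = y | t = z]].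
    by exists x; constructor 1.
  have tx : R t x by apply: tmin; constructor 1.
  have ty : R t y by apply: tmin; constructor 2.
  have tz : R t z by apply: tmin; constructor 3.
  case: h => E; rewrite E in tx ty tz; first by [].
    by move=> xy _; rewrite (Ra _ _ xy tx).
  by move=> xy yz; rewrite -(Ra _ _ yz ty).
pose lt (x y : {classic T}) := R x y /\ x <> y.
exists lt; split => //.
- by move=> x [].
- move=> x y z [xy nxy] [yz _]; split; first exact: trans xy yz.
  by move=> xz; apply: nxy; apply: Ra xy _; rewrite xz.
- move=> x y _ _; have [->|nxy] := EM (x = y); first by constructor 2.
  by case: (total x y) => h; [constructor 1|constructor 3]; split=> // /esym.
- move=> S _ /minP[x Sx xmin]; exists x => // y Sy [yx]; apply.
  exact: Ra yx (xmin _ Sy).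
Qed.

(** If no element bounded [f], then [A] would be the countable union of the countable sets of
    elements at or below [f n]. *)
Lemma countable_unbounded (A : woType) : ~ countable [set: A] ->
  (forall a : A, countable [set b | wo_lt b a]) ->
  forall f : nat -> A, exists a, forall n, wo_lt (f n) a.
Proof.
move=> unc cnt f; apply: contrapT => nobd; apply: unc.
have -> : [set: A] = \bigcup_(n in setT)
    \bigcup_(i in [set: bool]) (if i then [set b | wo_lt b (f n)] else [set f n]).
  apply/seteqP; split=> // a _; apply: contrapT => na; apply: nobd; exists a => n.
  apply: contrapT => /wo_notlt h; apply: na; exists n => //.
  by case: h => [->|h]; [exists false|exists true].
by apply: bigcup_countable => // n _; apply: bigcup_countable => // -[] _.
Qed.

Lemma uncountable_inhabited (T : Type) : ~ countable [set: T] -> inhabited T.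
Proof.
move=> unc; apply: contrapT => noT; apply: unc.
by apply/countable_injP; exists (fun=> 0) => t; case: noT.
Qed.

(** * Finitely many state descriptions *)

(** Each [s] has a threshold in [D]; the largest of these finitely many thresholds serves all
    [s]. *)
Lemma fin_bound (T : finType) (A : woType) (D : set A) (P : T -> A -> Prop) :
  D !=set0 ->
  (forall s, exists2 a, D a & forall b, D b -> ~ wo_lt b a -> P s b) ->
  exists2 a, D a & forall s, P s a.
Proof.
move=> [d0 Dd0] h.
suff [a Da aP] : exists2 a, D a & forall s b, s \in enum T -> D b -> ~ wo_lt b a -> P s b.
  by exists a => // s; apply: aP => //; [rewrite mem_enum|exact: wo_irr].
elim: (enum T) => [|s l [a Da aP]]; first by exists d0.
have [b Db bP] := h s; have [c [ca cb E]] := wo_max a b.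
exists c; first by case: E => ->.
move=> s' d; rewrite inE => /predU1P[->|s'l] Dd dc.
  by apply: bP => //; apply: wo_le_trans cb dc.
by apply: aP => //; apply: wo_le_trans ca dc.
Qed.

(** The step [F] takes a total function but depends only on its values below [a]; elsewhere [t0] is
    a dummy value. *)
Lemma wo_rec (A : woType) (T : Type) (t0 : T) (F : A -> (A -> T) -> T) :
  (forall a f g, (forall b, wo_lt b a -> f b = g b) -> F a f = F a g) ->
  exists x : A -> T, forall a, x a = F a x.
Proof.
move=> Fext; have wf : well_founded (@wo_lt A).
  by move=> a; elim/wo_ind: a => a IH; constructor.
pose F' a (f : forall b, wo_lt b a -> T) := F a (fun b =>
  match pselect (wo_lt b a) with left h => f b h | right _ => t0 end).
exists (Fix wf (fun=> T) F') => a; rewrite Fix_eq /F'.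
  apply: Fext => b ba; case: pselect => //.
move=> b f g fg; apply: Fext => c cb; case: pselect => // h; exact: fg.
Qed.

Section States.
Variable Phi : seq sentence.
Implicit Types (G D : set sentence) (p q f : sentence).

Definition state G : (size Phi).-tuple bool :=
  map_tuple (fun f => `[< G f >]) (in_tuple Phi).

(** A semantic stand-in for being a Boolean combination of members of [Phi]. *)
Definition determined f := forall G D,
  mcs G -> mcs D -> state G = state D -> G f -> D f.

Lemma state_eq G D f : state G = state D -> f \in Phi -> G f -> D f.
Proof.
move=> /(congr1 val)/= E; elim: Phi E => //= g l IH [E /IH{}IH].
by rewrite inE => /predU1P[->|/IH//] /asboolP; rewrite E => /asboolP.
Qed.

Lemma state_formula (C : set ((size Phi).-tuple bool)) :
  exists f, forall D, mcs D -> D f <-> C (state D).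
Proof.
(* Plain lists replace tuples, whose length would get in the way of the induction on [Phi]. *)
suff h : forall C : set (seq bool), exists f, forall D, mcs D ->
    D f <-> C [seq `[< D f >] | f <- Phi].
  have [f fP] := h [set s | exists2 t, C t & val t = s]; exists f => D mD; rewrite fP //.
  split=> [[t Ct E]|Cs]; last by exists (state D).
  by rewrite (_ : state D = t) //; apply: val_inj; rewrite E.
elim: Phi => [|g l IH] {}C.
  have [C0|nC0] := EM (C [::]).
    by exists (Atom 0 ▷ Atom 0)%cond => D mD; split=> // _; exact: cond_id.
  by exists (¬ (Atom 0 ▷ Atom 0))%cond => D mD; rewrite (mcsN mD); split=> // -[]; exact: cond_id.
have [f1 f1P] := IH [set s | C (true :: s)]; have [f0 f0P] := IH [set s | C (false :: s)].
exists ((g ∧ f1) ∨ (¬ g ∧ f0))%cond => D mD.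
rewrite (mcsO _ _ mD) !(mcsA _ _ mD) (mcsN mD) f1P // f0P //=.
have [Dg|nDg] := EM (D g).
  by rewrite (asboolT Dg); split=> [[[]|[]]//|]; left.
by rewrite (asboolF nDg); split=> [[[]|[]]//|]; right.
Qed.

End States.

(** A well-order of the uncountable set [nat -> bool] is cut at its first uncountable segment, if
    any. Of the first uncountable ordinal only the boundedness of countable sequences is kept. *)
Lemma omega1 : exists2 A : woType, inhabited A &
  forall f : nat -> A, exists a, forall n, wo_lt (f n) a.
Proof.
have [lt ltP] := well_orderable (nat -> bool); pose B := WoType ltP.
have [[b bP]|allc] := EM (exists b : B, ~ countable [set a | wo_lt a b]); last first.
  exists B; first exact: uncountable_inhabited uncountable_powerset.
  apply: countable_unbounded => [|a]; first exact: uncountable_powerset.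
  by apply: contrapT => na; apply: allc; exists a.
have [c cP cmin] := @wo_min B [set b | ~ countable [set a | wo_lt a b]] (ex_intro _ b bP).
have unc : ~ countable [set: wo_seg c].
  move=> cnt; apply: cP; have -> : [set a | wo_lt a c] = range (fun u : wo_seg c => sval u).
    by apply/seteqP; split=> [a ac|_ [u _ <-]]; [exists (exist _ a ac)|exact: svalP].
  exact: sub_countable (card_image_le _ _) cnt.
exists (wo_seg c); first exact: uncountable_inhabited.
apply: countable_unbounded => // u.
have /contrapT := contra_not (@cmin (sval u)) (fun k => k (svalP u)).
move=> /countable_injP[f finj]; apply/countable_injP; exists (fun v => f (sval v)).
move=> [v vc] [w wc] /set_mem vu /set_mem wu E; apply: eq_exist.
by apply: finj E; exact: mem_set.
Qed.

(** * Coherent runs of maximal consistent sets *)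

(* Passing from [b] to [a] without meeting [f] does not change what is true at the
   nearest [f]-point. *)
Definition coherent (A : woType) (x : A -> set sentence) (b a : A) (f : sentence) :=
  (forall c, ~ wo_lt c b -> wo_lt c a -> ~ x c f) ->
  forall q, x b (f ▷ q)%cond <-> x a (f ▷ q)%cond.

Section Run.
Variables (l : seq sentence) (w : set sentence) (mw : mcs w).
Variables (A : woType) (Abd : forall f : nat -> A, exists a, forall n, wo_lt (f n) a).

Definition settled (G : set sentence) := forall f, f \in l -> decides G f.

(** The necessities are included so that the state of a point shows whether it is settled. *)
Let Phi := l ++ [seq (□ f)%cond | f <- l] ++ [seq (□ ¬ f)%cond | f <- l].

Lemma mem_determined f : f \in l -> determined Phi f.
Proof. by move=> fl G D mG mD E; apply: state_eq E _; rewrite mem_cat fl. Qed.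

Lemma state_settled G D : state Phi G = state Phi D -> settled G -> settled D.
Proof.
move=> E setG f fl; case: (setG f fl) => h; [left|right];
  apply: (state_eq E) h; rewrite !mem_cat.
  by rewrite (map_f (fun f => □ f)%cond fl) orbT.
by rewrite (map_f (fun f => □ ¬ f)%cond fl) !orbT.
Qed.

Lemma sees_settled G : mcs G -> exists D, [/\ mcs D, sees G D & settled D].
Proof. exact: mckinsey_decides. Qed.

(** At a successor only the state of the predecessor recurs, so limits and successors are treated
    alike. At the least stage all states recur, vacuously. *)
Definition recurring (x : A -> set sentence) (a : A) : set ((size Phi).-tuple bool) :=
  [set s | forall b, wo_lt b a ->
    exists c, [/\ ~ wo_lt c b, wo_lt c a & state Phi (x c) = s]].

Lemma exit_formula : exists ex : set ((size Phi).-tuple bool) -> sentence,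
  forall C D, mcs D -> D (ex C) <-> ~ C (state Phi D).
Proof.
have /choice[ex exP] : forall C : set ((size Phi).-tuple bool), exists f, forall D,
    mcs D -> D f <-> ~ C (state Phi D).
  by move=> C; exact: state_formula [set s | ~ C s].
by exists ex.
Qed.

Variable ex : set ((size Phi).-tuple bool) -> sentence.
Hypothesis exP : forall C D, mcs D -> D (ex C) <-> ~ C (state Phi D).

(* The nearest point whose state does not recur below [a]. By flattening it is the
   same seen from all large enough [c] below [a], so no such [c] is singled out. *)
Definition next_point (a : A) (x : A -> set sentence) : set sentence :=
  if `[< exists b, wo_lt b a >] then
    [set q | exists2 b, wo_lt b a & forall c, ~ wo_lt c b -> wo_lt c a ->
      x c (ex (recurring x a) ▷ q)%cond]
  else w.

Lemma next_point_ext a x y : (forall b, wo_lt b a -> x b = y b) ->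
  next_point a x = next_point a y.
Proof.
move=> xy; rewrite /next_point; case: ifP => // _.
have -> : recurring x a = recurring y a.
  by apply/seteqP; split=> s h b /h[c [cb ca E]]; exists c; split=> //;
    rewrite -E xy.
by apply/seteqP; split=> q [b ba h]; exists b => // c cb ca; move: (h c cb ca);
  rewrite xy.
Qed.

Variable x : A -> set sentence.
Hypothesis xE : forall a, x a = next_point a x.

Lemma run_step a : (forall c, wo_lt c a -> ~ settled (x c)) ->
  [/\ mcs (x a),
      forall b f, wo_lt b a -> determined Phi f -> coherent x b a f &
      forall b, wo_lt b a -> ~ recurring x a (state Phi (x a))].
Proof.
elim/wo_ind: a => a IH0 uns.
have IH c : wo_lt c a -> [/\ mcs (x c),
    forall b f, wo_lt b c -> determined Phi f -> coherent x b c f &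
    forall b, wo_lt b c -> ~ recurring x c (state Phi (x c))].
  by move=> ca; apply: IH0 => // d dc; apply: uns; exact: wo_trans dc ca.
have [aS|a0] := EM (exists b, wo_lt b a); last first.
  have -> : x a = w by rewrite xE /next_point asboolF.
  by split=> // b *; case: a0; exists b.
set C := recurring x a; set N := ex C.
(* There are finitely many states, so from some [b0] on only recurring ones occur below [a]. *)
have [b0 b0a b0P] : exists2 b0, wo_lt b0 a &
    forall s c, ~ wo_lt c b0 -> wo_lt c a -> state Phi (x c) = s -> C s.
  apply: (@fin_bound _ A [set b | wo_lt b a]) => // s.
  have [Cs|/existsNP[b /not_implyP[ba nb]]] := EM (C s).
    by case: aS => b ba; exists b.
  exists b => // d da bd c dc ca E; case: nb; exists c; split=> //.
  exact: wo_le_trans bd dc.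
have {b0P} Cafter c : ~ wo_lt c b0 -> wo_lt c a -> C (state Phi (x c)).
  by move=> cb ca; exact: b0P cb ca erefl.
have Nafter c : ~ wo_lt c b0 -> wo_lt c a -> ~ x c N.
  by move=> cb ca; have [mc _ _] := IH _ ca; rewrite exP // => /(_ (Cafter _ cb ca)).
have Ndet : determined Phi N.
  by move=> G D mG mD E; rewrite !exP // E.
have coh b c f : determined Phi f -> wo_lt c a -> ~ wo_lt c b -> coherent x b c f.
  move=> df ca /wo_notlt[->|bc]; first by move=> _ q.
  by have [_ h _] := IH _ ca; exact: h.
have [mb0 _ _] := IH _ b0a.
(* From [b0] on [N] fails below [a], so by coherence all these stages agree on the nearest
   [N]-point. *)
have xaE : x a = near (x b0) N.
  rewrite xE /next_point asboolT //; apply/seteqP; split=> q.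
    move=> [b ba h]; have [c [cb cb0 E]] := wo_max b b0.
    have ca : wo_lt c a by case: E => ->.
    have := h c cb ca; rewrite -/C -/N.
    apply: (iffRL (coh _ _ _ Ndet ca cb0 _ q)) => d db0 dc; apply: Nafter db0 _.
    exact: wo_trans dc ca.
  move=> Nq; exists b0 => // c cb0 ca.
  apply: (iffLR (coh _ _ _ Ndet ca cb0 _ q)) => // d db0 dc; apply: Nafter db0 _.
  exact: wo_trans dc ca.
(* Were [N] impossible, a settled point seen from [x b0] would have a recurring state, and so some
   stage before [a] would already be settled. *)
have Npos : ~ x b0 (N ▷ ¬ N)%cond.
  move=> /(boxN mb0 N) bN; have [D [mD b0D setD]] := sees_settled mb0.
  have /(mcsN mD) := b0D _ bN; rewrite exP // => /contrapT /(_ b0 b0a)[c [_ ca E]].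
  by apply: (uns c ca); apply: state_settled setD.
have ma : mcs (x a) by rewrite xaE; exact: mcs_near.
split=> // [b f ba df nf q|b ba]; last first.
  by apply/(exP _ ma); rewrite xaE; exact: cond_id.
(* A state satisfying [f] cannot recur below [a], since [f] fails at all stages from [b] on. *)
have fN D : mcs D -> D f -> D N.
  move=> mD Df; rewrite exP // => /(_ b ba)[c [cb ca E]].
  have [mc _ _] := IH _ ca; apply: (nf c cb ca).
  exact: df (esym E) Df.
have -> : x a (f ▷ q)%cond <-> x b0 (f ▷ q)%cond by rewrite xaE; exact: cond_flat.
(* It remains to link [b] and [b0] by coherence, in either order: [f] fails from [b] on by
   assumption, and from [b0] on because it entails [N]. *)
have [bb0|b0b] := EM (wo_lt b b0).
  apply: coh => // [|c cb cb0]; first exact: wo_asym.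
  by apply: nf cb _; exact: wo_trans cb0 b0a.
apply: iff_sym; apply: coh => // c cb0 cb.
have ca := wo_trans cb ba; have [mc _ _] := IH _ ca.
by move=> /(fN _ mc); exact: Nafter.
Qed.

Lemma run_settles : inhabited A -> exists a, settled (x a).
Proof.
move=> [a0]; apply: contrapT => /forallNP uns.
have step a := @run_step a (fun c _ => uns c).
pose C := [set s | forall b, exists2 c, ~ wo_lt c b & state Phi (x c) = s].
have [b0 _ b0P] : exists2 b0, setT b0 &
    forall s c, ~ wo_lt c b0 -> state Phi (x c) = s -> C s.
  apply: fin_bound => [|s]; first by exists a0.
  have [Cs|/existsNP[b nb]] := EM (C s); first by exists a0.
  exists b => // d _ bd c dc E; case: nb; exists c => //.
  exact: wo_le_trans bd dc.
(* Between [b] and [h b] every cofinal state occurs; [Abd] provides upper bounds for pairs here. *)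
have /choice[h hP] : forall b, exists d, wo_lt b d /\ forall s, C s ->
    exists c, [/\ ~ wo_lt c b, wo_lt c d & state Phi (x c) = s].
  move=> b; have [d bd dP] : exists2 d, wo_lt b d &
      forall s, C s -> exists c, [/\ ~ wo_lt c b, wo_lt c d & state Phi (x c) = s].
    have above c : exists2 d, wo_lt b d & wo_lt c d.
      have [d dP] := Abd (fun n => if n is 0 then b else c).
      by exists d; [exact: dP 0|exact: dP 1].
    apply: (@fin_bound _ A (wo_lt b)); first by have [d] := above b; exists d.
    move=> s; have [/(_ b)[c cb E]|nCs] := EM (C s); last first.
      by have [d bd _] := above b; exists d.
    have [d bd cd] := above c; exists d => // e be de _; exists c; split=> //.
    exact: wo_lt_le_trans cd de.
  by exists d.
have [e eP] := Abd (fun n => iter n h b0).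
(* [d] is the supremum of the iterates of [h] from [b0], so every state in [C] recurs below it,
   while its own state lies in [C] because it comes after [b0]. *)
have [d dP dmin] := @wo_min A [set d | forall n, wo_lt (iter n h b0) d]
  (ex_intro _ e eP).
have [_ _ nrec] := step d; apply: (nrec b0); first exact: dP 0.
move=> b bd; have /existsNP[n nb] := contra_not (@dmin b) (fun k => k bd).
have Cd : C (state Phi (x d)) by apply: b0P erefl; exact/wo_asym/(dP 0).
have [c [cn cn1 E]] := (hP (iter n h b0)).2 _ Cd; exists c; split=> //.
  exact: wo_le_trans nb cn.
exact: wo_trans cn1 (dP n.+1).
Qed.

End Run.

Lemma settled_run (l : seq sentence) (w : set sentence) : mcs w ->
  exists (A : woType) (x : A -> set sentence) (a0 m : A),
    [/\ x a0 = w, forall a, ~ wo_lt m a, forall a, mcs (x a),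
      forall f, f \in l -> decides (x m) f &
      forall b a f, wo_lt b a -> f \in l -> coherent x b a f].
Proof.
move=> mw; have [B [b0] Bbd] := omega1; have [ex exP] := exit_formula l.
have [x xE] := wo_rec set0 (@next_point_ext l w B ex).
have [m setm mmin] : exists2 m, settled l (x m) & forall a, settled l (x a) -> ~ wo_lt a m.
  have [m setm] : exists a, settled l (x a) by exact: (run_settles mw Bbd exP xE).
  exact: (@wo_min B [set a | settled l (x a)]) (ex_intro _ m setm).
(* [s] is the successor of the first settled stage [m], so the segment below it has [m] as its last
   element. *)
have [s ms smin] : exists2 s, wo_lt m s & forall a, wo_lt m a -> ~ wo_lt a s.
  have [s sP] := Bbd (fun=> m).
  exact: (@wo_min B (wo_lt m)) (ex_intro _ s (sP 0)).
have lem (a : wo_seg s) : ~ wo_lt m (sval a) by move=> /smin; apply; exact: (svalP a).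
have step (a : wo_seg s) := run_step mw exP xE (fun c (ca : wo_lt c (sval a)) setc =>
  mmin c setc (wo_lt_le_trans ca (lem a))).
have [z _ zmin] := @wo_min B setT (ex_intro _ b0 I).
have zs : wo_lt z s := wo_le_lt_trans (zmin m I) ms.
exists (wo_seg s), (fun a => x (sval a)), (exist _ z zs), (exist _ m ms).
split=> //= [|a|b a f ba fl nf q].
- by rewrite xE /next_point asboolF // => -[b /zmin]; exact.
- by have [] := step a.
- have [_ h _] := step a; apply: h => //; first exact: mem_determined.
  move=> c cb ca; have cs := wo_trans ca (svalP a).
  exact: (nf (exist _ c cs)).
Qed.

(** * The canonical sequence of a run *)

(** The element of rank γ picked by [cid] is unique, by [orank_inj]. *)
Definition run_seq (P : Type) (A : woType) (x : A -> P) : oseq P :=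
  OSeq (fun g : {γ | olt γ (otype A)} => x (sval (cid ((ltoP A _).1 (svalP g))))).

Lemma run_seqE (P : Type) (A : woType) (x : A -> P) a h :
  oval (o := run_seq x) (exist _ (orank a) h) = x a.
Proof. by rewrite /=; case: cid => b /= /orank_inj ->. Qed.

Fixpoint subsentences (p : sentence) : seq sentence :=
  p :: match p with
       | Atom _ => [::]
       | Neg p => subsentences p
       | And p q | Cond p q => subsentences p ++ subsentences q
       end.

Section Truth.
Variables (l : seq sentence) (A : woType) (x : A -> set sentence) (m : A).
Hypothesis lem : forall a, ~ wo_lt m a.
Hypothesis mx : forall a, mcs (x a).
Hypothesis xm : forall f, f \in l -> decides (x m) f.
Hypothesis xcoh : forall b a f, wo_lt b a -> f \in l -> coherent x b a f.

Let σ := run_seq x.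

Let W : set (oseq (set sentence)) := [set τ | exists a : A, is_tail σ (orank a) τ].

(** The same tail may start at several positions; by [tail_head] these carry the same set. *)
Let V (k : nat) (τ : oseq (set sentence)) : bool :=
  `[< exists2 a : A, is_tail σ (orank a) τ & x a (Atom k) >].

Lemma tail_pos (a : A) τ : is_tail σ (orank a) τ -> olt ozero (olen τ).
Proof.
move=> [E _]; apply/(olt_add2lE (orank a)); rewrite oadd0 E.
by apply/ltoP; exists a.
Qed.

Lemma tail_head (a b : A) τ : is_tail σ (orank a) τ -> is_tail σ (orank b) τ -> x a = x b.
Proof.
suff head (c : A) (t : is_tail σ (orank c) τ) : oval (exist _ ozero (tail_pos t)) = x c.
  by move=> ta tb; rewrite -(head _ ta) -(head _ tb); exact: oval_eq.
have h : olt (orank c) (olen σ) by apply/ltoP; exists c.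
have h' : olt (oadd (orank c) ozero) (olen σ) by rewrite oadd0.
by rewrite (t.2 _ _ h') -(run_seqE h); apply: oval_eq; rewrite oadd0.
Qed.

Lemma tail_after (a b : A) τ : is_tail σ (orank a) τ -> ~ wo_lt b a ->
  exists δ ρ, [/\ oadd (orank a) δ = orank b, is_tail σ (orank b) ρ & is_tail τ δ ρ].
Proof.
move=> t ab; have /ole_subr[δ E] : ole (orank a) (orank b) by apply/oleNgt => /orank_lt.
have [ρ tρ] : exists ρ, is_tail σ (orank b) ρ.
  by apply: tail_exists; left; apply/ltoP; exists b.
by exists δ, ρ; split=> //; apply: tail_sub t _; rewrite E.
Qed.

(** Members of [W] are non-empty, so the index of ρ in σ stays below the length of σ and is the rank
    of an element. *)
Lemma after_tail (a : A) τ δ ρ : is_tail σ (orank a) τ -> is_tail τ δ ρ -> W ρ ->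
  exists b : A, [/\ ~ wo_lt b a, oadd (orank a) δ = orank b & is_tail σ (orank b) ρ].
Proof.
move=> t tρ [c /tail_pos ρ0]; have tσ := tail_comp t tρ.
have /ltoP[b E] : olt (oadd (orank a) δ) (otype A).
  rewrite -[otype A](proj1 tσ) -{1}[oadd _ δ]oadd0; exact: olt_add2l.
exists b; split=> //; last by rewrite -E.
by move=> /orank_lt; apply/oleNgt; rewrite -E; exact: ole_addr.
Qed.

Lemma truth p : {subset subsentences p <= l} -> forall (a : A) τ,
  is_tail σ (orank a) τ -> denot W (tail_order W) V p τ <-> x a p.
Proof.
elim: p => [k|p IH|p IHp q IHq|p IHp q IHq] sub a τ t; have Wτ : W τ by exists a.
- split=> [[_ /asboolP[b tb]]|xk]; first by rewrite (tail_head t tb).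
  by split=> //; apply/asboolP; exists a.
- rewrite (denotN _ _ Wτ) (mcsN (mx a)) (IH _ a) // => f fp.
  by apply: sub; rewrite inE fp orbT.
- rewrite (mcsA _ _ (mx a)) -(IHp _ a τ) -?(IHq _ a τ) // => f fp;
    by apply: sub; rewrite inE mem_cat fp !orbT.
have sp : {subset subsentences p <= l}.
  by move=> f fp; apply: sub; rewrite inE mem_cat fp orbT.
have sq : {subset subsentences q <= l}.
  by move=> f fq; apply: sub; rewrite inE mem_cat fq !orbT.
move/(_ sp) in IHp; move/(_ sq) in IHq.
have pl : p \in l by apply: sp; case: (p) => *; exact: mem_head.
have coh b : ~ wo_lt b a -> (forall c, ~ wo_lt c a -> wo_lt c b -> ~ x c p) ->
    x a (p ▷ q)%cond <-> x b (p ▷ q)%cond.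
  by move=> /wo_notlt[->//|ab] np; exact: xcoh.
have [[b ab xb]|none] := EM (exists2 b, ~ wo_lt b a & x b p); last first.
  split=> _.
    (* With [p] never met from [a] on, coherence carries the conditional to [m]. There [p] is
       decided and false, hence impossible, and the conditional is vacuous. *)
    have np : ~ x m p by move=> xmp; apply: none; exists m.
    apply/(coh m) => // [c ca _ xc|]; first by apply: none; exists c.
    case: (xm pl) => [/(sees_refl (mx m))//|/(box_cond (mx m) p) pnp].
    by apply: (cond_mono2 (mx m)) pnp (cond_id (mx m) p) => D mD /(mcsN mD).
  apply: denot_cond_none => // δ ρ tρ pρ; have [b [ab _ tb]] := after_tail t tρ (denotW pρ).
  by apply: none; exists b => //; apply/(IHp _ _ tb).
(* At the first stage [c] from [a] on that contains [p], coherence has preserved the conditional and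
   centering reduces it to [q]. *)
have [c [ac xc] cmin] := @wo_min A [set b | ~ wo_lt b a /\ x b p]
  (ex_intro _ b (conj ab xb)).
have [δ [ρ [E tc tρ]]] := tail_after t ac.
have fρ : first_tail W V p τ δ ρ.
  split=> // [|γ χ γδ tχ pχ]; first exact/(IHp _ _ tc).
  have [d [ad E' td]] := after_tail t tχ (denotW pχ).
  apply: (cmin d); first by split=> //; apply/(IHp _ _ td).
  by apply/orank_lt; rewrite -E -E'; exact: olt_add2l.
rewrite (denot_cond_first _ Wτ fρ) (IHq _ _ tc) (coh c) //; last first.
  by move=> d da dc xd; apply: (cmin d).
by rewrite (cond_center (mx c) _ xc).
Qed.

(** The tail starting at [m] is final: as [m] is the last element, any later index either starts
    there too or gives the empty tail, which is outside [W]. *)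
Lemma run_frame : final_ordinal_sequence_frame W.
Proof.
split.
  apply: tail_order_frame; have [τ t] : exists τ, is_tail σ (orank m) τ.
    by apply: tail_exists; left; apply/ltoP; exists m.
  by exists τ, m.
move=> τ [a t]; have [δ [ρ [E tm tρ]]] := tail_after t (@lem a).
exists δ, ρ; split=> //; first by exists m.
move=> γ χ δγ tχ Wχ; have [b [ab E' tb]] := after_tail t tχ Wχ.
suff -> : χ = ρ by []; apply: tail_uniq tb _; suff -> : b = m by [].
case: (wo_notlt (@lem b)) => // bm.
have : ole (orank m) (orank b).
  by rewrite -E -E'; case: δγ => [h|->]; [left; exact: olt_add2l|right].
by move=> /oleNgt; case; apply/orank_lt.
Qed.

End Truth.

(** * Soundness and weak completeness *)

Theorem theorem6p5 (p : sentence) :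
  C2FM p <->
  (forall (P : Type) (W : set (oseq P)),
     inhabited P -> final_ordinal_sequence_frame W ->
     frame_valid W (tail_order W) p).
Proof.
split=> [Lp P W _|valid]; first exact: soundness.
apply: contrapT => /lindenbaum[G mG nGp].
have [A [x [a0 [m [x0 lem mx xm xcoh]]]]] := settled_run (subsentences p) mG.
have [τ t] : exists τ, is_tail (run_seq x) (orank a0) τ.
  by apply: tail_exists; left; apply/ltoP; exists a0.
apply: nGp; rewrite -x0; apply/(truth lem mx xm xcoh _ t) => //.
by apply: (valid _ _ (inhabits set0) (run_frame x lem)); exists a0.
Qed.
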